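(* Let $0<q<1$, let $X, X_0, X_1, X_2,\ldots$ be almost surely non-negative i.i.d. random variables with $\mathbb{E}\log\max(X,1)<\infty$, and let $S=\sum_{n=0}^\infty q^n X_n$ and $M=\sup_{n\geq 0} q^n X_n$. Let $\mathbb{P}(X=0)=p_0>0$. Then $$-\log \mathbb{P}(M \leq \varepsilon) \sim -\log \mathbb{P}(S \leq \varepsilon) \sim \frac{\log (1/p_0)}{\log (1/q)} \,\log (1/\varepsilon),\qquad \text{as } \varepsilon\to 0.$$
   Context: Here $\varepsilon\to 0$ means $\varepsilon\downarrow 0$ through positive values, and $f\sim g$ means $\lim f/g=1$. In the degenerate case $p_0=1$ all terms of the asymptotic relation are identically zero, and the relation is understood to hold trivially. The condition $\mathbb{E}\log\max(X,1)<\infty$ is the necessary and sufficient condition for $S<\infty$ almost surely. *)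

(* Defs.v *)
From HB Require Import structures.
From mathcomp Require Import all_boot all_order all_algebra.
From mathcomp Require Import finmap.
From mathcomp Require Import all_classical all_reals all_analysis.

Set Implicit Arguments.
Unset Strict Implicit.
Unset Printing Implicit Defensive.

Import Order.TTheory GRing.Theory Num.Theory.
Import numFieldNormedType.Exports.

Local Open Scope classical_set_scope.
Local Open Scope ring_scope.

Section iid.
Context d (T : measurableType d) (R : realType) (P : probability T R).

Definition mutually_independent (I : choiceType)
    (X : I -> {RV P >-> R}) : Prop :=
  forall (J : {fset I}) (B : I -> set R),
    (forall i, i \in J -> measurable (B i)) ->
    P (\bigcap_(i in [set` J]) (X i @^-1` B i)) =
    (\prod_(i <- J) P (X i @^-1` B i))%E.

(* Equality of laws is required on Borel sets only: [distribution P X] also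
   takes meaningless values on non-measurable sets. *)
Definition identically_distributed (X Y : {RV P >-> R}) : Prop :=
  forall B : set R, measurable B -> distribution P X B = distribution P Y B.

End iid.

Section weighted.
Context (T : Type) (R : realType) (q : R) (X : nat -> T -> R).

Definition weighted_sum (w : T) : \bar R :=
  (\sum_(0 <= n <oo) (q ^+ n * X n w)%:E)%E.

Definition weighted_sup (w : T) : \bar R :=
  ereal_sup (range (fun n => (q ^+ n * X n w)%:E)).

End weighted.

Section asymptotics.
Context (R : realType).

(* The first disjunct is the convention that 0 ~ 0: the quotient [0 / 0] is [0]
   here, so the limit alone would fail when both sides vanish identically. *)
Definition sim_at0 (f g : R -> R) : Prop :=
  (forall e : R, 0 < e -> f e = 0 /\ g e = 0) \/
  (f e / g e @[e --> 0^'+] --> (1 : R)).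

End asymptotics.

(* Main.v *)
Require Import Defs.
From HB Require Import structures.
From mathcomp Require Import all_boot all_order all_algebra.
From mathcomp Require Import finmap.
From mathcomp Require Import all_classical all_reals all_analysis.
From mathcomp Require Import measurable_realfun ring lra.

(** With [c = ln (1 / p0)], [L = ln (1 / q)] and [x = ln (1 / e)], the claim is
    that [- ln P(M <= e)] and [- ln P(S <= e)] are both asymptotic to
    [(c / L) * x].  As the variables are almost surely nonnegative, [M <= S]
    almost surely, so [P(S <= e) <= P(M <= e)] ([weighted_sum_le_sup]), and it
    is enough to bound [P(M <= e)] from above and [P(S <= e)] from below.

    Both events are governed by how many of the first variables have to vanish.
    The number [N] of indices with [q ^ n] larger than a constant times [e] is
    [x / L] up to a bounded error ([geometric_bracket]).

    For [M], the event [M <= e] forces [X_n <= e / q ^ n] for every [n < N], and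
    these thresholds are all at most a fixed [x0] as soon as [e <= q ^ N * x0].
    By right-continuity at [0] of the distribution function, [P(X <= x0)] is
    below any prescribed [b > p0] for [x0] small, whence [P(M <= e) <= b ^ N]
    ([weighted_sup_prob_le]).

    For [S], consider the event that [X_n = 0] for [n < N] and that
    [0 <= X_(N + j) <= r ^ - (k + j + 1)] for all [j], where [r = sqrt q].  On it the
    sum is at most a constant times [q ^ N], since
    [q ^ j * r ^ - j = r ^ j] is summable.  By independence its probability is
    [p0 ^ N] times an infinite product, and that product is at least [1 / 2] for
    [k] large, because finiteness of [E ln (max X 1)] makes the probabilities
    [P(X > r ^ - n)] summable ([tail_probability_summable],
    [weighted_sum_prob_ge]).  Imposing bounds on the individual variables,
    rather than on the remainder of the series, keeps the argument within the
    independence of the given family.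

    Hence, for every positive [b' < c / L],
    [b' * x - O(1) <= - ln P(M <= e) <= - ln P(S <= e) <= (c / L) * x + O(1)],
    and both ratios tend to [1] ([cvg_ratio_ln]).  When [p0 = 1] all variables
    vanish almost surely and both logarithms are [0]. *)

Set Implicit Arguments.
Unset Strict Implicit.
Unset Printing Implicit Defensive.

Import Order.TTheory GRing.Theory Num.Theory.
Import numFieldNormedType.Exports.

Local Open Scope classical_set_scope.
Local Open Scope ring_scope.

(** * Independent events *)

(** Independence is stated for finite sets of indices; initial segments are the
    only ones used below. *)
Lemma independent_initial d (T : measurableType d) (R : realType)
    (P : probability T R) (X : nat -> {RV P >-> R}) (B : nat -> set R) n :
    mutually_independent X -> (forall i, measurable (B i)) ->
  P (\bigcap_(i in `I_n) (X i @^-1` B i)) =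
  (\prod_(0 <= i < n) P (X i @^-1` B i))%E.
Proof.
move=> iX mB.
pose J : {fset nat} := [fset i in iota 0 n]%fset.
have := iX J B (fun i _ => mB i).
have -> : [set` J] = `I_n.
  by apply/seteqP; split => i /=; rewrite in_fset mem_iota add0n.
move=> ->; rewrite /index_iota subn0; apply: perm_big.
apply: uniq_perm; rewrite ?fset_uniq ?iota_uniq// => i.
by rewrite in_fset.
Qed.

(** Continuity from above carries a lower bound from the finite products to the
    intersection of the whole sequence of events. *)
Lemma independent_bigcap_ge d (T : measurableType d) (R : realType)
    (P : probability T R) (X : nat -> {RV P >-> R}) (B : nat -> set R)
    (c : \bar R) :
    mutually_independent X -> (forall i, measurable (B i)) ->
    (\forall n \near \oo, c <= \prod_(0 <= i < n) P (X i @^-1` B i))%E ->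
  (c <= P (\bigcap_i (X i @^-1` B i)))%E.
Proof.
move=> iX mB cP.
have mXB i : measurable (X i @^-1` B i) by exact: measurable_funPTI.
pose F n := \bigcap_(i in `I_n) (X i @^-1` B i).
have FE : \bigcap_n F n = \bigcap_i (X i @^-1` B i).
  apply/seteqP; split => w Fw i _; last by move=> j _; exact: Fw.
  by apply: (Fw i.+1) => //=.
rewrite -FE.
have mF n : measurable (F n) by apply: bigcap_measurableType => i _.
have cvgF : P \o F @ \oo --> P (\bigcap_n F n).
  apply: nonincreasing_cvg_mu => //.
  - by rewrite (le_lt_trans (probability_le1 P (mF 0%N)))// ltry.
  - exact: bigcapT_measurable.
  - apply/nonincreasing_seqP => n; apply/subsetPset => w Fw i /= ni.
    by apply: Fw => /=; rewrite (ltn_trans ni).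
rewrite -(cvg_lim _ cvgF)//; apply: lime_ge.
  by apply/cvg_ex; exists (P (\bigcap_n F n)).
by apply: filterS cP => n /=; rewrite independent_initial.
Qed.

(** * Measurability of the weighted sum and supremum *)

Lemma limn_einf_esup_cvg (R : realType) (u : (\bar R)^nat) :
  limn_einf u = limn_esup u -> u @ \oo --> limn_esup u.
Proof.
move=> ue; have ub : \forall n \near \oo, (einfs u n <= u n <= esups u n)%E.
  apply: nearW => n; apply/andP; split.
    by apply: ereal_inf_lbound; exists n => /=.
  by apply: ereal_sup_ubound; exists n => /=.
apply: (squeeze_cvge ub).
- by rewrite -ue limn_einf_lim; exact: is_cvg_einfs.
- by rewrite limn_esup_lim; exact: is_cvg_esups.
Qed.

(** A sequence of extended reals converges exactly when its inferior and superior
    limits agree, and [limn] returns a default value otherwise.  This makes the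
    measurability of [limn] provable without any convergence assumption, which
    matters because the partial sums of [weighted_sum] may diverge on a null set,
    and a subset of a null set need not be measurable. *)
Lemma limnE (R : realType) (u : (\bar R)^nat) :
  limn u = if limn_einf u == limn_esup u then limn_esup u else point.
Proof.
case: eqP => ue; first exact/cvg_lim/limn_einf_esup_cvg.
apply: xgetPN => l ul; apply: ue.
by have [-> ->] := cvg_limn_einf_sup ul.
Qed.

Lemma measurable_limn d (T : measurableType d) (R : realType)
    (u : nat -> T -> \bar R) :
    (forall n, measurable_fun setT (u n)) ->
  measurable_fun setT (fun w => limn (u^~ w)).
Proof.
move=> mu.
have msup : measurable_fun setT (fun w => limn_esup (u^~ w)).
  exact: measurable_fun_limn_esup.
have minf : measurable_fun setT (fun w => limn_einf (u^~ w)).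
  have : measurable_fun setT (fun w => - limn_esup (fun n => - u n w))%E.
    apply: measurableT_comp => //; apply: measurable_fun_limn_esup => n.
    exact: measurableT_comp.
  apply: eq_measurable_fun => w _.
  by rewrite -[RHS]oppeK -limn_esupN.
under eq_fun do rewrite limnE.
apply: measurable_fun_ifT => //.
exact: measurable_fun_eqe.
Qed.

Lemma measurable_weighted_sum_le d (T : measurableType d) (R : realType)
    (q e : R) (X : nat -> T -> R) :
    (forall n, measurable_fun setT (X n)) ->
  measurable [set w | (weighted_sum q X w <= e%:E)%E].
Proof.
move=> mX; rewrite -[X in measurable X]setTI.
apply: emeasurable_fun_infty_c => //; apply: measurable_limn => n.
apply: emeasurable_sum => i; apply/measurable_EFinP.
exact: measurable_funM.
Qed.

Lemma weighted_sup_leE (T : Type) (R : realType) (q e : R)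
    (X : nat -> T -> R) :
  [set w | weighted_sup q X w <= e%:E]%E =
  \bigcap_n X n @^-1` [set x | q ^+ n * x <= e].
Proof.
apply/seteqP; split => w /= Mw.
  move=> n _ /=; rewrite -lee_fin; apply: le_trans Mw.
  by apply: ereal_sup_ubound; exists n.
by apply: ge_ereal_sup => _ [n _ <-]; rewrite lee_fin; exact: Mw.
Qed.

Lemma measurable_weighted_sup_le d (T : measurableType d) (R : realType)
    (q e : R) (X : nat -> T -> R) :
    (forall n, measurable_fun setT (X n)) ->
  measurable [set w | (weighted_sup q X w <= e%:E)%E].
Proof.
move=> mX; rewrite weighted_sup_leE; apply: bigcapT_measurable => n.
rewrite -[X in measurable X]setTI; apply: measurable_fun_le => //.
exact: measurable_funM.
Qed.

(** * Tail probabilities and products *)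

(** When the last multiple [n * l] is at most [y], bounding every term by [1] is
    enough; otherwise its term vanishes and the induction hypothesis applies. *)
Lemma count_multiples_le (R : realType) (l y : R) n : 0 < l -> 0 <= y ->
  l * (\sum_(0 <= k < n) ((k.+1%:R : R) * l <= y)%R%:R) <= y.
Proof.
move=> l0 y0; elim: n => [|n ih]; first by rewrite big_geq// mulr0.
rewrite big_nat_recr//=; have [ny|ny] := leP (n.+1%:R * l) y;
  last by rewrite addr0.
apply: le_trans ny; rewrite mulrC ler_pM2r// -natr1 lerD2r.
rewrite (@le_trans _ _ (\sum_(0 <= k < n) 1))//.
  by apply: ler_sum => i _; rewrite lern1 leq_b1.
by rewrite sumr_const_nat subn0.
Qed.

(** Summing the indicators of [n.+1 * l <= Y] counts the multiples of [l] below
    [Y], so the sum of the probabilities is at most the expectation of [Y / l]. *)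
Lemma tail_probability_summable d (T : measurableType d) (R : realType)
    (P : probability T R) (Y : T -> R) (l : R) :
    measurable_fun setT Y -> (forall w, 0 <= Y w) -> 0 < l ->
    ('E_P[Y] < +oo)%E ->
  (\sum_(0 <= n <oo) P [set w | n.+1%:R * l <= Y w]%R < +oo)%E.
Proof.
move=> mY Y0 l0 EY.
pose A n := [set w | n.+1%:R * l <= Y w].
have mA n : measurable (A n).
  by rewrite -[A n]setTI; exact: measurable_fun_le.
suff H : ((l%:E) * (\sum_(0 <= n <oo) P (A n)) <= 'E_P[Y])%E.
  apply: (@le_lt_trans _ _ (l^-1%:E * 'E_P[Y])%E); first by rewrite lee_pdivlMl.
  by rewrite lte_mul_pinfty// lee_fin invr_ge0 ltW.
have -> : (\sum_(0 <= n <oo) P (A n) =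
    \sum_(0 <= n <oo) \int[P]_w (\1_(A n) w)%:E)%E.
  by apply: eq_eseriesr => n _; rewrite integral_indic// setIT.
have m1 n : measurable_fun setT (fun w => (\1_(A n) w : R)%:E).
  by apply/measurable_EFinP; exact: measurable_indic.
rewrite -integral_nneseries//.
have mS : measurable_fun setT (fun w => \sum_(0 <= n <oo) (\1_(A n) w : R)%:E)%E.
  by apply: ge0_emeasurable_sum.
rewrite -ge0_integralZl_EFin//; last 2 first.
- by move=> w _; apply: nneseries_ge0.
- exact: ltW.
rewrite [in leRHS]unlock; apply: ge0_le_integral => //.
- move=> w _; apply: mule_ge0; [by rewrite lee_fin ltW|exact: nneseries_ge0].
- exact: measurable_funeM.
- by apply/measurable_EFinP.
move=> w _.
rewrite muleC -lee_pdivlMr//.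
apply: lime_le; first by apply: is_cvg_nneseries.
apply: nearW => n; rewrite lee_pdivlMr// muleC sumEFin -EFinM lee_fin.
apply: le_trans _ (count_multiples_le n l0 (Y0 w)).
by rewrite ler_pM2l// ler_sum// => i _; rewrite indicE /A mem_setE.
Qed.

(** Weierstrass product inequality. *)
Lemma prod_ge_1_sum (R : realDomainType) (t : nat -> R) n :
    (forall i, 0 <= t i <= 1) ->
  1 - \sum_(0 <= i < n) t i <= \prod_(0 <= i < n) (1 - t i).
Proof.
move=> t01; elim: n => [|n ih]; first by rewrite !big_geq// subr0.
rewrite !big_nat_recr//=.
have p01 : 0 <= \prod_(0 <= i < n) (1 - t i) <= 1.
  apply/andP; split.
    by apply: prodr_ge0 => i _; rewrite subr_ge0; case/andP: (t01 i).
  by apply: prodr_ile1 => i _; rewrite subr_ge0 lerBlDr lerDl andbC; exact: t01.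
have /andP[t0 t1] := t01 n; nra.
Qed.

Lemma lee_prod_nat (R : realDomainType) m n (f g : nat -> \bar R) :
    (forall i, (m <= i < n)%N -> 0 <= f i <= g i)%E ->
  (\prod_(m <= i < n) f i <= \prod_(m <= i < n) g i)%E.
Proof.
move=> fg.
suff /andP[//] : (0 <= \prod_(m <= i < n) f i <= \prod_(m <= i < n) g i)%E.
rewrite big_nat [X in (_ <= _ <= X)%E]big_nat.
apply: (big_ind2 (fun x y : \bar R => 0 <= x <= y)%E).
- by rewrite lee01 lexx.
- move=> x1 x2 y1 y2 /andP[x10 x12] /andP[y10 y12].
  by rewrite mule_ge0//= lee_pmul.
- exact: fg.
Qed.

(** A bound uniform in [n], so that it passes to the limit of the partial sums.
    The induction is on the sharper bound [C * (1 - r ^+ (n - N))], whose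
    truncated subtraction covers the first [N] terms as well. *)
Lemma partial_sum_le_geometric (R : realFieldType) (r C : R) N
    (x : nat -> R) n :
    0 < r < 1 -> 0 <= C ->
    (forall i, (i < N)%N -> x i <= 0) -> (forall j, x (N + j)%N <= C * r ^+ j) ->
  \sum_(0 <= i < n) x i <= C / (1 - r).
Proof.
move=> /andP[r0 r1] C0 xN xj.
have r1' : 0 < 1 - r by rewrite subr_gt0.
suff H : (1 - r) * \sum_(0 <= i < n) x i <= C * (1 - r ^+ (n - N)).
  rewrite ler_pdivlMr// mulrC (le_trans H)// ler_piMr// gerBl.
  by rewrite exprn_ge0// ltW.
elim: n => [|n ih]; first by rewrite big_geq// sub0n expr0 subrr !mulr0.
rewrite big_nat_recr//= mulrDr; have [Nn|nN] := leqP N n.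
  have := xj (n - N)%N; rewrite subnKC// subSn// exprS => xn.
  have := ler_wpM2l (ltW r1') xn; nra.
have nN0 : (n - N = 0)%N by apply/eqP; rewrite subn_eq0 ltnW.
move: ih; rewrite nN0 (eqP nN) expr0 => ih.
have := ler_wpM2l (ltW r1') (xN _ nN); lra.
Qed.

(** * Small-ball probabilities *)

Lemma ae_ge0_lt0 d (T : measurableType d) (R : realType)
    (P : probability T R) (X : {RV P >-> R}) :
  {ae P, forall w, 0 <= X w} -> P (X @^-1` `]-oo, 0[) = 0.
Proof.
move=> X0; apply/negligibleP; first exact: measurable_funPTI.
apply: negligibleS X0 => w /=; rewrite in_itv/= => Xw.
by apply/negP; rewrite -ltNge.
Qed.

(** Each of the first [N] factors is at most the distribution function of [X] at
    [x0], which is below [b] for [x0] small by right-continuity at [0]. *)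
Lemma weighted_sup_prob_le d (T : measurableType d) (R : realType)
    (P : probability T R) (q b : R) (X : {RV P >-> R})
    (Xn : nat -> {RV P >-> R}) :
    0 < q < 1 -> {ae P, forall w, 0 <= X w} -> mutually_independent Xn ->
    (forall n, identically_distributed (Xn n) X) ->
    (P [set w | X w = 0%R] < b%:E)%E ->
  exists2 x0, 0 < x0 & forall N e, e <= q ^+ N * x0 ->
    (P [set w | weighted_sup q (fun n => Xn n : T -> R) w <= e%:E] <=
     (b ^+ N)%:E)%E.
Proof.
move=> /andP[q0 q1] X0 iX idX PX0.
have cdf0 : (cdf X 0 < b%:E)%E.
  rewrite /cdf /distribution /pushforward /=.
  rewrite (_ : X @^-1` _ = [set w | X w = 0] `|` X @^-1` `]-oo, 0[); last first.
    apply/seteqP; split => w /=; rewrite !in_itv/= le_eqVlt.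
      by move=> /predU1P[]; [left|right].
    by move=> [->|->]; rewrite ?eqxx ?orbT.
  rewrite measureU0//; [|exact: measurable_funPTI|exact: ae_ge0_lt0].
  exact: (measurable_funPTI X (measurable_set1 0)).
have [x0 x00 cdfx0] : exists2 x0, 0 < x0 & (cdf X x0 < b%:E)%E.
  have : \forall x \near 0^'+, (cdf X x < b%:E)%E.
    apply: (@cdf_right_continuous _ _ _ P X 0 [set y | (y < b%:E)%E]).
    by apply: open_nbhs_nbhs; split; [exact: open_ereal_lt_ereal|].
  move=> near_b; near (0 : R)^'+ => x.
  by exists x => //; near: x.
exists x0 => // N e eN.
have -> : [set w | weighted_sup q (fun n => Xn n : T -> R) w <= e%:E]%E =
    \bigcap_n Xn n @^-1` [set x | q ^+ n * x <= e] by exact: weighted_sup_leE.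
have mB n : measurable [set x : R | q ^+ n * x <= e].
  by rewrite -[X in measurable X]setTI; apply: measurable_fun_le.
have mXB n : measurable (Xn n @^-1` [set x | q ^+ n * x <= e]).
  exact: measurable_funPTI.
apply: (@le_trans _ _
  (P (\bigcap_(n in `I_N) (Xn n @^-1` [set x | q ^+ n * x <= e])))).
  apply: le_measure; rewrite ?inE.
  - exact: bigcapT_measurable.
  - by apply: bigcap_measurableType => i _.
  - by move=> w Xw n _; exact: Xw.
rewrite independent_initial//.
have -> : (b ^+ N)%:E = (\prod_(0 <= i < N) b%:E)%E.
  by rewrite prodEFin prodr_const_nat subn0.
apply: lee_prod_nat => i /andP[_ iN]; rewrite measure_ge0/=.
apply: le_trans (ltW cdfx0).
rewrite /cdf -(idX i)//; apply: le_measure; rewrite ?inE//.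
  exact: measurable_funPTI.
move=> w /=; rewrite in_itv/= => qX.
rewrite -(@ler_pM2l _ (q ^+ i)) ?exprn_gt0// (le_trans qX)// (le_trans eN)//.
by rewrite ler_pM2r// ler_wiXn2l ?ltW// ltnW.
Unshelve. all: by end_near. Qed.

(** The event used asks the first [N] variables to vanish and the next ones to
    stay below a geometrically growing threshold.  The shift [k] in the threshold
    is chosen so that the second requirement costs at most one half, whatever
    [N] is; a bound without [N] in the constants is what makes the logarithm of
    the probability linear in [N] up to a bounded error. *)
Lemma weighted_sum_prob_ge d (T : measurableType d) (R : realType)
    (P : probability T R) (q p0 : R) (X : {RV P >-> R})
    (Xn : nat -> {RV P >-> R}) :
    0 < q < 1 -> {ae P, forall w, 0 <= X w} -> mutually_independent Xn ->
    (forall n, identically_distributed (Xn n) X) ->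
    ('E_P[fun w => ln (Num.max (X w) 1)%R] < +oo)%E ->
    P [set w | X w = 0%R] = p0%:E ->
  exists2 K, 0 < K & forall N,
    ((2^-1 * p0 ^+ N)%:E <=
     P [set w | weighted_sum q (fun n => Xn n : T -> R) w <= (q ^+ N * K)%:E])%E.
Proof.
move=> /andP[q0 q1] X0 iX idX EX PX0.
(* Any ratio strictly between [q] and [1] would do for the thresholds. *)
pose r := Num.sqrt q; have r0 : 0 < r by rewrite sqrtr_gt0.
have r1 : r < 1 by rewrite -sqrtr1 ltr_sqrt.
have qr : q = r ^+ 2 by rewrite sqr_sqrtr// ltW.
pose l := - ln r; have l0 : 0 < l by rewrite oppr_gt0 ln_lt0// r0.
pose Y w := ln (Num.max (X w) 1).
have mY : measurable_fun setT Y.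
  apply: measurableT_comp => //; apply: measurable_maxr => //.
have Y0 w : 0 <= Y w by rewrite ln_ge0// le_max lexx orbT.
pose A n := [set w | n.+1%:R * l <= Y w].
have mA n : measurable (A n).
  by rewrite -[A n]setTI; exact: measurable_fun_le.
have [k tailk] : exists k, (\sum_(k <= n <oo) P (A n) < 2^-1%:E)%E.
  have := nneseries_tail_cvg (tail_probability_summable mY Y0 l0 EX)
    (fun n _ => measure_ge0 P _).
  have h0 : (0 < 2^-1%:E :> \bar R)%E by rewrite lte_fin invr_gt0.
  move=> /(_ [set y | (y < 2^-1%:E)%E]).
  case; first by apply: open_nbhs_nbhs; split; [exact: open_ereal_lt_ereal|].
  by move=> k _ kH; exists k; apply: kH => /=.
have p00 : 0 <= p0 by rewrite -lee_fin -PX0.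
pose C := r ^- k.+1.
have C0 : 0 < C by rewrite invr_gt0 exprn_gt0.
exists (C / (1 - r)); first by rewrite divr_gt0// subr_gt0.
move=> N.
(* The lower bound [0] gives the nonnegative terms that make the series
   converge everywhere on the event. *)
pose B i := if (i < N)%N then [set 0] else `[0, r ^- (k + (i - N)).+1]%classic.
have mB i : measurable (B i) by rewrite /B; case: ifP => _.
have PB i : P (Xn i @^-1` B i) = P (X @^-1` B i) by exact: idX.
have PBhead i : (i < N)%N -> P (Xn i @^-1` B i) = p0%:E.
  by move=> iN; rewrite PB /B iN.
have PBtail j : (1 - P (A (k + j)%N) <= P (Xn (N + j)%N @^-1` B (N + j)%N))%E.
  rewrite PB /B ltnNge leq_addr/= addKn -probability_setC//.
  (* The event [B (N + j)] also asks for nonnegativity, which costs a null set. *)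
  rewrite -[leRHS](measureU0 (mu := P) (B := X @^-1` `]-oo, 0[)); first last.
  - exact: ae_ge0_lt0.
  - exact: measurable_funPTI.
  - exact: measurable_funPTI.
  apply: le_measure; rewrite ?inE.
  - exact: measurableC.
  - by apply: measurableU; exact: measurable_funPTI.
  move=> w /= /negP; rewrite !in_itv/= -ltNge => YA.
  have [Xw0|Xw0] := ltP (X w) 0; [by right|left].
  have XY : X w <= expR (Y w).
    by rewrite lnK ?posrE ?lt_max ?ltr01 ?orbT// le_max lexx.
  rewrite /= (le_trans XY)//.
  rewrite -[leRHS]lnK ?posrE ?invr_gt0 ?exprn_gt0// ler_expR.
  rewrite lnV ?posrE ?exprn_gt0// lnXn// -mulNrn -mulr_natl.
  exact: ltW.
have Bhead i x : (i < N)%N -> B i x -> x = 0 by rewrite /B => ->.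
have Btail j x : B (N + j)%N x -> 0 <= x <= C * r ^- j.
  rewrite /B ltnNge leq_addr/= addKn in_itv/= => /andP[-> xr]/=.
  by rewrite (le_trans xr)// /C -invfM -exprD addSn.
have B0 i x : B i x -> 0 <= x.
  have [iN /(Bhead _ _ iN)->//|Ni] := ltnP i N.
  by rewrite -(subnKC Ni) => /Btail/andP[].
apply: (@le_trans _ _ (P (\bigcap_i (Xn i @^-1` B i)))); last first.
  apply: le_measure; rewrite ?inE.
  - by apply: bigcapT_measurable => i; exact: measurable_funPTI.
  - by apply: measurable_weighted_sum_le => n.
  move=> w XB /=; rewrite mulrA; apply: lime_le.
    apply: is_cvg_nneseries => n _ _; rewrite lee_fin mulr_ge0 ?exprn_ge0 ?(ltW q0)//.
    exact: (B0 n _ (XB n Logic.I)).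
  apply: nearW => n; rewrite sumEFin lee_fin.
  apply: (@partial_sum_le_geometric _ r _ N); rewrite ?r0//.
  - by rewrite mulr_ge0 ?exprn_ge0// ltW.
  - by move=> i iN; rewrite (Bhead _ _ iN (XB i Logic.I)) mulr0.
  move=> j; rewrite exprD -!mulrA ler_pM2l ?exprn_gt0//.
  have /andP[_ XC] := Btail _ _ (XB (N + j)%N Logic.I).
  rewrite (le_trans (ler_wpM2l _ XC)) ?exprn_ge0 ?(ltW q0)//.
  rewrite qr -exprM mulnC exprM expr2 mulrCA -mulrA divff ?mulr1//.
  by rewrite gt_eqF// exprn_gt0.
apply: independent_bigcap_ge => //.
exists N => // n /= Nn.
rewrite (big_cat_nat (n := N))//=.
rewrite muleC EFinM; apply: lee_pmul.
- by rewrite lee_fin.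
- by rewrite lee_fin exprn_ge0.
- rewrite -[in leRHS](add0n N) big_addn.
  have PAE j : P (A j) = (fine (P (A j)))%:E by rewrite fineK// fin_num_measure.
  pose t j := fine (P (A (k + j)%N)).
  have t01 j : 0 <= t j <= 1.
    by rewrite -!lee_fin -PAE measure_ge0 probability_le1.
  apply: (@le_trans _ _ (\prod_(0 <= j < n - N) (1 - t j)%:E)%E); last first.
    apply: lee_prod_nat => j _; rewrite lee_fin subr_ge0.
    have /andP[_ ->]/= := t01 j.
    by rewrite EFinB /t -PAE (addnC j N); exact: PBtail.
  rewrite prodEFin lee_fin (le_trans _ (prod_ge_1_sum _ t01))//.
  suff : \sum_(0 <= j < n - N) t j <= 2^-1 by lra.
  rewrite -lee_fin -sumEFin (le_trans _ (ltW tailk))//.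
  under eq_bigr do rewrite -PAE.
  apply: (@le_trans _ _ (\sum_(k <= j < n - N + k) P (A j))%E).
    rewrite -[in leRHS](add0n k) big_addn addnK.
    by apply: lee_sum => j _; rewrite addnC.
  by apply: nneseries_lim_ge.
have -> : (p0 ^+ N)%:E = (\prod_(0 <= i < N) p0%:E)%E.
  by rewrite prodEFin prodr_const_nat subn0.
by apply: lee_prod_nat => i /andP[_ iN]; rewrite PBhead// lee_fin p00 lexx.
Qed.

(** The series dominates each of its terms outside the null set where some
    variable is negative. *)
Lemma weighted_sum_le_sup d (T : measurableType d) (R : realType)
    (P : probability T R) (q e : R) (Xn : nat -> {RV P >-> R}) :
    0 < q -> (forall n, {ae P, forall w, 0 <= Xn n w}) ->
  (P [set w | weighted_sum q (fun n => Xn n : T -> R) w <= e%:E] <=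
   P [set w | weighted_sup q (fun n => Xn n : T -> R) w <= e%:E])%E.
Proof.
move=> q0 X0.
have mS :
    measurable [set w | (weighted_sum q (fun n => Xn n : T -> R) w <= e%:E)%E].
  by apply: measurable_weighted_sum_le => n.
have mM :
    measurable [set w | (weighted_sup q (fun n => Xn n : T -> R) w <= e%:E)%E].
  by apply: measurable_weighted_sup_le => n.
(* The good event is cut out by countably many conditions, so its complement
   is measurable and null. *)
pose Z := \bigcup_n (Xn n @^-1` `]-oo, 0[).
have mZ : measurable Z.
  by apply: bigcupT_measurable => n; exact: measurable_funPTI.
have PZ : P Z = 0.
  apply/negligibleP => //; apply: negligible_bigcup => n.
  by apply/negligibleP; [exact: measurable_funPTI|exact: ae_ge0_lt0].
rewrite -[leRHS](measureU0 (mu := P) mM mZ PZ).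
apply: le_measure; rewrite ?inE//; first exact: measurableU.
move=> w /= Sw; have [Zw|Zw] := pselect (Z w); [by right|left].
have Xw n : 0 <= Xn n w.
  by rewrite leNgt; apply/negP => Xw; apply: Zw; exists n => //=; rewrite in_itv.
apply: le_trans Sw; apply: ge_ereal_sup => _ [n _ <-].
have term_ge0 i : (0 <= (q ^+ i * Xn i w)%:E)%E.
  by rewrite lee_fin mulr_ge0 ?exprn_ge0 ?(ltW q0).
apply: le_trans (nneseries_lim_ge (m := 0) n.+1 _) => //.
by rewrite big_nat_recr//= leeDr// sume_ge0.
Qed.

(** The case [p0 = 1]: the probability has to be exactly [1], so the one half of
    [weighted_sum_prob_ge] does not suffice. *)
Lemma weighted_sum_eq0_prob d (T : measurableType d) (R : realType)
    (P : probability T R) (q e : R) (Xn : nat -> {RV P >-> R}) :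
    0 <= e -> mutually_independent Xn ->
    (forall n, P [set w | Xn n w = 0%R] = 1%E) ->
  P [set w | weighted_sum q (fun n => Xn n : T -> R) w <= e%:E]%E = 1%E.
Proof.
move=> e0 iX X1.
have mS :
    measurable [set w | (weighted_sum q (fun n => Xn n : T -> R) w <= e%:E)%E].
  by apply: measurable_weighted_sum_le => n.
apply/eqP; rewrite eq_le probability_le1//=.
apply: (@le_trans _ _ (P (\bigcap_n (Xn n @^-1` [set 0])))).
  apply: (independent_bigcap_ge (B := fun=> [set 0])) => //.
  apply: nearW => n; rewrite big1// => i _; exact: X1.
apply: le_measure; rewrite ?inE//.
  by apply: bigcapT_measurable => i; exact: measurable_funPTI.
move=> w Xw /=; rewrite /weighted_sum eseries0// => n _ _.
by rewrite (Xw n Logic.I) mulr0.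
Qed.

(** * Asymptotics at zero *)

Lemma ln_inv_cvg_pinfty (R : realType) : ln (1 / e) @[e --> (0 : R)^'+] --> +oo.
Proof.
have /cvgNry := @lnNy R; apply: cvg_trans; apply: near_eq_cvg.
by near=> e; rewrite /= div1r lnV ?posrE.
Unshelve. all: by end_near. Qed.

(** The lower slopes only approach [a]: the supremum is controlled through a base
    strictly above [p0], which gives slopes strictly below the limiting one. *)
Lemma cvg_ratio_ln (R : realType) (f : R -> R) (a : R) :
    0 < a ->
    (exists C, \forall e \near (0 : R)^'+, f e <= a * ln (1 / e) + C) ->
    (forall b, 0 < b < a ->
      exists C, \forall e \near (0 : R)^'+, b * ln (1 / e) - C <= f e) ->
  f e / (a * ln (1 / e)) @[e --> (0 : R)^'+] --> (1 : R).
Proof.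
move=> a0 [C fC] fb; apply/cvgrPdist_le => eps eps0.
(* Capping [eps] at [1] keeps the slope [a * (1 - dl / 2)] positive. *)
pose dl := Num.min eps 1.
have dl0 : 0 < dl by rewrite lt_min eps0/=.
have dl1 : dl <= 1 by rewrite ge_min lexx orbT.
have dle : dl <= eps by rewrite ge_min lexx.
have [|D fD] := fb (a * (1 - dl / 2)).
  by apply/andP; split; [apply: mulr_gt0 => //; lra|rewrite gtr_pMr//; lra].
have /cvgryPge ln_ge := @ln_inv_cvg_pinfty R.
have /cvgryPgt ln_gt := @ln_inv_cvg_pinfty R.
near=> e.
have x0 : 0 < ln (1 / e) by near: e; exact: ln_gt.
have xC : C / (a * dl) <= ln (1 / e) by near: e; exact: ln_ge.
have xD : D / (a * dl / 2) <= ln (1 / e) by near: e; exact: ln_ge.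
have fe1 : f e <= a * ln (1 / e) + C by near: e.
have fe2 : a * (1 - dl / 2) * ln (1 / e) - D <= f e by near: e.
apply: le_trans dle; rewrite distrC ler_distl.
have ax0 : 0 < a * ln (1 / e) by rewrite mulr_gt0.
rewrite ler_pdivlMr// ler_pdivrMr//.
move: xC xD; rewrite !ler_pdivrMr ?divr_gt0 ?mulr_gt0// => xC xD.
set x := ln _ in xC xD fe1 fe2 *.
apply/andP; split; lra.
Unshelve. all: by end_near. Qed.

Lemma cvg_ratio_common (R : realType) (f g h : R -> R) (F : set_system R) :
    Filter F -> (\forall x \near F, h x != 0) ->
    f x / h x @[x --> F] --> (1 : R) -> g x / h x @[x --> F] --> (1 : R) ->
  f x / g x @[x --> F] --> (1 : R).
Proof.
move=> FF h0 fh gh.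
have hg : (g x / h x)^-1 @[x --> F] --> (1^-1 : R).
  by apply: cvgV gh; exact: oner_neq0.
have : (f x / h x) * (g x / h x)^-1 @[x --> F] --> (1 * 1^-1 : R).
  exact: cvgM fh hg.
rewrite invr1 mulr1; apply: cvg_trans; apply: near_eq_cvg.
by apply: filterS h0 => x hx0; rewrite /= invf_div mulrA divfK.
Qed.

(** The two forms of the same bracketing: the multiplicative one is what the
    probability bounds take as input, the logarithmic one says that [N] is
    [ln (1 / e) / ln (1 / q)] up to a bounded error. *)
Lemma geometric_bracket (R : realType) (q K e : R) : 0 < q < 1 -> 0 < e <= K ->
  exists N, [/\ q ^+ N.+1 * K <= e, e <= q ^+ N * K,
    N%:R * ln (1 / q) <= ln K + ln (1 / e) &
    ln K + ln (1 / e) <= N.+1%:R * ln (1 / q)].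
Proof.
move=> /andP[q0 q1] /andP[e0 eK].
have K0 : 0 < K by exact: lt_le_trans eK.
have l0 : 0 < ln (1 / q) by rewrite ln_gt0// div1r invf_gt1.
pose y := (ln K + ln (1 / e)) / ln (1 / q).
have y0 : 0 <= y.
  rewrite divr_ge0 ?(ltW l0)// div1r lnV ?posrE// subr_ge0 ler_ln//.
have /andP[Ny yN] := truncn_itv y0.
set N := Num.trunc y in Ny yN.
have qN n : ln (q ^+ n * K) = ln K - n%:R * ln (1 / q).
  rewrite lnM ?posrE ?exprn_gt0// lnXn// div1r lnV ?posrE// -mulr_natl; lra.
have H1 : N%:R * ln (1 / q) <= ln K + ln (1 / e) by rewrite -ler_pdivlMr.
have H2 : ln K + ln (1 / e) <= N.+1%:R * ln (1 / q).
  by rewrite -ler_pdivrMr// ltW.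
have el : ln (1 / e) = - ln e by rewrite div1r lnV ?posrE.
exists N; split => //.
- rewrite -ler_ln ?posrE ?mulr_gt0 ?exprn_gt0// qN; lra.
- rewrite -ler_ln ?posrE ?mulr_gt0 ?exprn_gt0// qN; lra.
Qed.

(** * Logarithmic asymptotics of the small-ball probabilities *)

Theorem theorem10 (R : realType) (d : measure_display) (T : measurableType d)
    (P : probability T R) (q p0 : R)
    (X : {RV P >-> R}) (Xn : nat -> {RV P >-> R})
    (hq0 : 0 < q) (hq1 : q < 1)
    (hX_ge0 : {ae P, forall w, 0 <= X w})
    (hXn_ge0 : forall n, {ae P, forall w, 0 <= Xn n w})
    (hindep : mutually_independent Xn)
    (hident : forall n, identically_distributed (Xn n) X)
    (hlog : ('E_P[fun w => ln (Num.max (X w) 1)%R] < +oo)%E)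
    (hp0 : P [set w | X w = 0] = p0%:E) (hp0_gt0 : 0 < p0) :
  let S := weighted_sum q (fun n => Xn n : T -> R) in
  let M := weighted_sup q (fun n => Xn n : T -> R) in
  let neglogM := fun e : R => - ln (fine (P [set w | (M w <= e%:E)%E])) in
  let neglogS := fun e : R => - ln (fine (P [set w | (S w <= e%:E)%E])) in
  sim_at0 neglogM neglogS /\
  sim_at0 neglogS (fun e => ln (1 / p0) / ln (1 / q) * ln (1 / e)).
Proof.
move=> S M neglogM neglogS.
have q01 : 0 < q < 1 by rewrite hq0.
have SM e : (P [set w | S w <= e%:E] <= P [set w | M w <= e%:E])%E.
  exact: weighted_sum_le_sup.
have mS e : measurable [set w | (S w <= e%:E)%E].
  by apply: measurable_weighted_sum_le => n.
have mM e : measurable [set w | (M w <= e%:E)%E].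
  by apply: measurable_weighted_sup_le => n.
have p01 : p0 <= 1.
  rewrite -lee_fin -hp0 probability_le1//.
  exact: (measurable_funPTI X (measurable_set1 0)).
have [p1|p1] := eqVneq p0 1.
  have S1 e : 0 < e -> P [set w | (S w <= e%:E)%E] = 1%E.
    move=> e0; apply: weighted_sum_eq0_prob => //; first exact: ltW.
    by move=> n; rewrite -[RHS]/(1%:E) -p1 -hp0; exact: (hident n [set 0]).
  have M1 e : 0 < e -> P [set w | (M w <= e%:E)%E] = 1%E.
    by move=> e0; apply/eqP; rewrite eq_le probability_le1//= -(S1 e).
  have nS e : 0 < e -> neglogS e = 0.
    by move=> e0; rewrite /neglogS S1//= ln1 oppr0.
  have nM e : 0 < e -> neglogM e = 0.
    by move=> e0; rewrite /neglogM M1//= ln1 oppr0.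
  by split; left => e e0; rewrite ?nS ?nM// p1 divr1 ln1 !mul0r.
have {}p01 : p0 < 1 by rewrite lt_neqAle p1.
set L := ln (1 / q); set c := ln (1 / p0).
have L0 : 0 < L by rewrite ln_gt0// div1r invf_gt1.
have c0 : 0 < c by rewrite ln_gt0// div1r invf_gt1.
have cE : c = - ln p0 by rewrite /c div1r lnV ?posrE.
have [K K0 SK] := weighted_sum_prob_ge q01 hX_ge0 hindep hident hlog hp0.
have SKe N e : q ^+ N * K <= e ->
    2^-1 * p0 ^+ N <= fine (P [set w | (S w <= e%:E)%E]).
  move=> NK; rewrite -lee_fin fineK ?fin_num_measure// (le_trans (SK N))//.
  apply: le_measure; rewrite ?inE//.
  by move=> w /= Sw; rewrite (le_trans Sw)// lee_fin.
have half_gt0 N : 0 < 2^-1 * p0 ^+ N by rewrite mulr_gt0// exprn_gt0.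
have PS_gt0 e : 0 < e -> 0 < fine (P [set w | (S w <= e%:E)%E]).
  move=> e0; have [eK|Ke] := leP e K.
    have [|N [NK _ _ _]] := @geometric_bracket R q K e q01; first by rewrite e0.
    exact: lt_le_trans (SKe _ _ NK).
  by apply: lt_le_trans (half_gt0 0%N) (SKe _ _ _); rewrite mul1r ltW.
have MS e : 0 < e -> neglogM e <= neglogS e.
  move=> e0; rewrite lerN2 ler_ln ?posrE ?PS_gt0//.
    by rewrite fine_le ?fin_num_measure.
  by rewrite (lt_le_trans (PS_gt0 _ e0))// fine_le ?fin_num_measure.
have a0 : 0 < c / L by rewrite divr_gt0.
have upper :
    exists C, \forall e \near (0 : R)^'+, neglogS e <= c / L * ln (1 / e) + C.
  exists (ln 2 + c + c / L * ln K).
  near=> e.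
  have e0 : 0 < e by [].
  have [|N [NK _ NL _]] := @geometric_bracket R q K e q01.
    by rewrite e0/=; near: e; apply: nbhs_right_le.
  have : ln (2^-1 * p0 ^+ N.+1) <= - neglogS e.
    by rewrite opprK ler_ln ?posrE ?PS_gt0//; exact: SKe.
  rewrite lnM ?posrE ?exprn_gt0// lnV ?posrE// lnXn// -mulr_natl -natr1.
  have : N%:R * c <= c / L * (ln K + ln (1 / e)).
    by rewrite -mulrA mulrC ler_pM2l// mulrC ler_pdivlMr.
  rewrite cE; lra.
(* With [b * L] in place of [c], the base [expR (- (b * L))] exceeds [p0]. *)
have lower b : 0 < b < c / L ->
    exists C, \forall e \near (0 : R)^'+, b * ln (1 / e) - C <= neglogM e.
  move=> /andP[b0 bcL].
  have [|x0 x00 Mx0] := @weighted_sup_prob_le _ _ _ P q (expR (- (b * L))) X Xn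
    q01 hX_ge0 hindep hident.
    rewrite hp0 lte_fin -[ltLHS]lnK ?posrE// ltr_expR.
    move: bcL; rewrite ltr_pdivlMr// cE; lra.
  exists (b * L - b * ln x0).
  near=> e.
  have e0 : 0 < e by [].
  have [|N [_ eN _ NL]] := @geometric_bracket R q x0 e q01.
    by rewrite e0/=; near: e; apply: nbhs_right_le.
  have : - neglogM e <= ln (expR (- (b * L)) ^+ N).
    have PM0 : 0 < fine (P [set w | (M w <= e%:E)%E]).
      by rewrite (lt_le_trans (PS_gt0 _ e0))// fine_le ?fin_num_measure.
    rewrite opprK ler_ln ?posrE ?exprn_gt0 ?expR_gt0//.
    by rewrite -lee_fin fineK ?fin_num_measure//; exact: Mx0.
  rewrite lnXn ?expR_gt0// expRK -mulr_natl.
  have := ler_wpM2l (ltW b0) NL; rewrite -natr1 -/L; lra.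
have gS : neglogS e / (c / L * ln (1 / e)) @[e --> (0 : R)^'+] --> (1 : R).
  apply: cvg_ratio_ln => // b /lower[C HC]; exists C.
  by near=> e; apply: le_trans (MS e _) => //; near: e.
have gM : neglogM e / (c / L * ln (1 / e)) @[e --> (0 : R)^'+] --> (1 : R).
  apply: cvg_ratio_ln => //; have [C HC] := upper; exists C.
  by near=> e; apply: (le_trans (MS e _)) => //; near: e.
split; right => //.
apply: cvg_ratio_common gM gS; near=> e; rewrite gt_eqF// mulr_gt0//.
by near: e; move/cvgryPgt : (@ln_inv_cvg_pinfty R); apply.
Unshelve. all: by end_near.
Qed.
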